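(* Let $f:X\to X$ be a continuous map on a metric space $(X,d)$ and assume that $f$ has dense range, i.e. $f(X)$ is dense in $(X,d)$. If the dynamical system $(X,f)$ is not topologically mixing, then the extended dynamical system $((\mathcal{F}(X),d_E),\hat f)$, where $\hat f$ is the Zadeh extension of $f$ and $d_E$ the endograph metric, does not have the finite shadowing property.
   Context: Write $\mathbb{I}=[0,1]$ and $\mathbb{N}=\{1,2,\dots\}$. Fuzzy sets: for $u:X\to\mathbb{I}$ set $u_\alpha=\{x: u(x)\ge\alpha\}$ for $\alpha\in(0,1]$ and $u_0=\overline{\{x:u(x)>0\}}$. $\mathcal{F}(X)$ (normal fuzzy sets) is the set of all upper-semicontinuous $u:X\to\mathbb{I}$ such that $u_0$ is compact and $u_1$ is non-empty. The Zadeh extension of a continuous $f:X\to X$ is $\hat f:\mathcal{F}(X)\to\mathcal{F}(X)$, $[\hat f(u)](x)=\sup\{u(y): y\in f^{-1}(\{x\})\}$ if $f^{-1}(\{x\})\neq\varnothing$ and $[\hat f(u)](x)=0$ otherwise (it is well defined). Endograph metric: on $X\times\mathbb{I}$ put $\overline d((x,\alpha),(y,\beta))=\max\{d(x,y),|\alpha-\beta|\}$, and let $\overline d_H(C_1,C_2)=\max\{\sup_{p\in C_1}\overline d(p,C_2),\sup_{q\in C_2}\overline d(q,C_1)\}$ be the Hausdorff distance between non-empty closed subsets of $X\times\mathbb{I}$ (with $\overline d(p,C)=\inf_{c\in C}\overline d(p,c)$). For $u\in\mathcal{F}(X)$ let $\mathrm{end}(u)=\{(x,\alpha)\in X\times\mathbb{I}:u(x)\ge\alpha\}$;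 then $d_E(u,v)=\overline d_H(\mathrm{end}(u),\mathrm{end}(v))$. The map $\hat f$ is $d_E$-continuous. A system $(X,f)$ is topologically mixing if for every pair of non-empty open sets $U,V\subset X$ there is $n_0\in\mathbb{N}$ such that $f^n(U)\cap V\neq\varnothing$ for all $n\ge n_0$. Finite shadowing: let $g:Y\to Y$ be a continuous map on a metric space $(Y,r)$. A finite sequence $(y_j)_{j=0}^n$ ($n\in\mathbb{N}$) in $Y$ is an $r$-$\delta$-chain if $r(g(y_j),y_{j+1})<\delta$ for all $0\le j\le n-1$; it is $r$-$\varepsilon$-shadowed by the $g$-orbit of $y\in Y$ if $r(g^j(y),y_j)<\varepsilon$ for all $0\le j\le n$. The system $(Y,g)$ has the finite shadowing property if for every $\varepsilon>0$ there is $\delta_\varepsilon>0$ such that every $r$-$\delta_\varepsilon$-chain is $r$-$\varepsilon$-shadowed by the $g$-orbit of some point of $Y$. *)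

(* Defs.v *)
From HB Require Import structures.
From mathcomp Require Import all_boot all_order all_algebra.
From mathcomp Require Import all_classical all_reals all_analysis.

Set Implicit Arguments.
Unset Strict Implicit.
Unset Printing Implicit Defensive.

Import Order.TTheory GRing.Theory Num.Theory.
Import numFieldNormedType.Exports.

Local Open Scope classical_set_scope.
Local Open Scope ring_scope.

Definition topologically_mixing (X : topologicalType) (f : X -> X) : Prop :=
  forall U V : set X, open U -> open V -> U !=set0 -> V !=set0 ->
  exists2 n0 : nat, (0 < n0)%N &
    forall n : nat, (n0 <= n)%N -> (iter n f @` U) `&` V !=set0.

(** A finite sequence (y_0, ..., y_n) is represented by a function on [nat] of
    which only the values at 0, ..., n are used. *)
Section finite_shadowing.
Context {R : realType} {Y : Type}.
Variables (r : Y -> Y -> R) (g : Y -> Y).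

Definition is_chain (delta : R) (n : nat) (y : nat -> Y) : Prop :=
  forall j : nat, (j < n)%N -> r (g (y j)) (y j.+1) < delta.

Definition shadowed_by (eps : R) (n : nat) (y : nat -> Y) (z : Y) : Prop :=
  forall j : nat, (j <= n)%N -> r (iter j g z) (y j) < eps.

Definition finite_shadowing : Prop :=
  forall eps : R, 0 < eps -> exists2 delta : R, 0 < delta &
    forall (n : nat) (y : nat -> Y), (0 < n)%N ->
      is_chain delta n y -> exists z : Y, shadowed_by eps n y z.

End finite_shadowing.

Definition upper_semicontinuous {R : realType} {X : topologicalType}
    (u : X -> R) : Prop :=
  forall (x : X) (a : R), u x < a -> \forall y \near x, u y < a.

Definition level {R : realType} {X : topologicalType} (u : X -> R) (a : R) :
    set X :=
  if a == 0 then closure [set x | 0 < u x] else [set x | a <= u x].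

Record normal_fuzzy (R : realType) (X : topologicalType) := NormalFuzzy {
  membership :> X -> R;
  membership_itv : forall x, 0 <= membership x <= 1;
  membership_usc : upper_semicontinuous membership;
  compact_level0 : compact (level membership 0);
  level1_neq0 : level membership 1 !=set0
}.

Definition zadeh_fun {R : realType} {X : Type} (f : X -> X) (u : X -> R)
    (x : X) : R :=
  if pselect (f @^-1` [set x] !=set0) then sup (u @` (f @^-1` [set x])) else 0.

Section zadeh.
Context {R : realType} {X : metricType R}.
Variables (f : X -> X) (fc : continuous f).
Implicit Type u : normal_fuzzy R X.

Lemma zadeh_fun_ge u y : u y <= zadeh_fun f u (f y).
Proof.
rewrite /zadeh_fun; case: pselect => [? /=|]; last by case; exists y.
apply: ub_le_sup; last by exists y.
by exists 1 => _ [z _ <-]; case/andP: (membership_itv u z).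
Qed.

Lemma zadeh_fun_le u x (b : R) : 0 <= b ->
  (forall y, f y = x -> u y <= b) -> zadeh_fun f u x <= b.
Proof.
move=> b0 ub; rewrite /zadeh_fun; case: pselect => [[y fy] /=|] //.
by apply: ge_sup; [exists (u y); exists y | move=> _ [z /= fz <-]; exact: ub].
Qed.

Lemma zadeh_fun_itv u x : 0 <= zadeh_fun f u x <= 1.
Proof.
apply/andP; split; last first.
  by apply: zadeh_fun_le => // y _; case/andP: (membership_itv u y).
have [[y fy]|nx] := pselect (f @^-1` [set x] !=set0); last first.
  by rewrite /zadeh_fun; case: pselect.
have <- : f y = x by [].
by apply: le_trans (zadeh_fun_ge u y); case/andP: (membership_itv u y).
Qed.

Lemma zadeh_fun_usc u : upper_semicontinuous (zadeh_fun f u).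
Proof.
move=> x a xa; pose b := (zadeh_fun f u x + a) / 2.
have xb : zadeh_fun f u x < b by rewrite midf_lt.
have ba : b < a by rewrite midf_lt.
have b0 : 0 < b.
  by apply: le_lt_trans xb; case/andP: (zadeh_fun_itv u x).
pose C := [set y | b <= u y].
have Ccl : closed C.
  rewrite -openC openE => y /= /negP; rewrite -ltNge => yb.
  have := membership_usc yb; apply: filterS => z zb.
  by rewrite /C /= => /(lt_le_trans zb); rewrite ltxx.
have Cc : compact C.
  refine (subclosed_compact Ccl (@compact_level0 _ _ u) _) => y /= by_.
  by rewrite /level eqxx; apply: subset_closure; exact: lt_le_trans by_.
have fCcl : closed (f @` C).
  apply: compact_closed; first exact: metric_hausdorff.
  by apply: continuous_compact => //; apply: continuous_subspaceT.
have : \forall y \near x, (~` (f @` C)) y.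
  apply: open_nbhs_nbhs; split; first by rewrite openC.
  move=> [y Cy fy]; move: xb; rewrite ltNge => /negP; apply.
  by rewrite -fy; apply: le_trans (zadeh_fun_ge u y).
apply: filterS => z nz; apply: le_lt_trans ba.
apply: zadeh_fun_le => [|y fy]; first exact: ltW.
by rewrite leNgt; apply/negP => /ltW yb; apply: nz; exists y.
Qed.

Lemma zadeh_fun_compact u : compact (level (zadeh_fun f u) 0).
Proof.
have fc0 : compact (f @` level u 0).
  apply: continuous_compact; last exact: compact_level0.
  exact: continuous_subspaceT.
apply: (subclosed_compact _ fc0).
  by rewrite /level eqxx; exact: closed_closure.
have fcl : closed (f @` level u 0).
  by apply: compact_closed => //; exact: metric_hausdorff.
rewrite {1}/level eqxx ((closure_id (f @` level u 0)).1 fcl).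
apply: closureS => x /= x0.
apply: contrapT => nx; move: x0; rewrite ltNge => /negP; apply.
apply: zadeh_fun_le => // y fy; rewrite leNgt; apply/negP => y0.
apply: nx; exists y => //; rewrite /level eqxx.
exact: subset_closure.
Qed.

Lemma zadeh_fun_level1 u : level (zadeh_fun f u) 1 !=set0.
Proof.
have [y] := level1_neq0 u; rewrite /level oner_eq0 /= => y1.
by exists (f y); apply: le_trans (zadeh_fun_ge u y).
Qed.

Definition zadeh u : normal_fuzzy R X :=
  NormalFuzzy (zadeh_fun_itv u) (@zadeh_fun_usc u) (@zadeh_fun_compact u)
    (zadeh_fun_level1 u).

End zadeh.

Section endograph_metric.
Context {R : realType} {X : metricType R}.
Implicit Types (p q : X * R) (C D : set (X * R)) (u v : normal_fuzzy R X).

Definition dist_bar p q : R := Num.max (mdist p.1 q.1) `|p.2 - q.2|.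

Definition dist_to_set p C : R := inf [set dist_bar p c | c in C].

(** [sup] and [inf] are the real-valued ones, hence meaningful only for
    non-empty bounded sets; [endograph_dist_to_set_has_inf] and
    [endograph_dist_has_sup] show that this is the case for endographs, even
    when [X] is unbounded. *)
Definition hausdorff_dist C D : R :=
  Num.max (sup [set dist_to_set p D | p in C])
          (sup [set dist_to_set q C | q in D]).

Definition endograph (u : X -> R) : set (X * R) :=
  [set p | 0 <= p.2 <= 1 /\ p.2 <= u p.1].

Definition endograph_dist u v : R :=
  hausdorff_dist (endograph u) (endograph v).

Lemma endograph0 u x : endograph u (x, 0).
Proof.
by split=> /=; rewrite ?lexx ?ler01//; case/andP: (membership_itv u x).
Qed.

Lemma endograph_dist_to_set_has_inf p u :
  has_inf [set dist_bar p c | c in endograph u].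
Proof.
split; first by exists (dist_bar p (p.1, 0)), (p.1, 0) => //; exact: endograph0.
by exists 0 => _ [q _ <-]; rewrite /dist_bar le_max mdist_ge0.
Qed.

Lemma endograph_dist_has_sup u v :
  has_sup [set dist_to_set p (endograph v) | p in endograph u].
Proof.
split.
  have [x _] := level1_neq0 u.
  by eexists; exists (x, 0); [exact: endograph0 | reflexivity].
exists 1 => _ [p [/andP[p0 p1] _] <-].
apply: (@le_trans _ _ (dist_bar p (p.1, 0))).
  apply: ge_inf; first by case: (endograph_dist_to_set_has_inf p v).
  by exists (p.1, 0) => //; exact: endograph0.
by rewrite /dist_bar /= mdistxx subr0 ger0_norm// ge_max ler01 p1.
Qed.

End endograph_metric.

(* Main.v *)
Require Import Defs.
From mathcomp Require Import all_boot all_order all_algebra.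
From mathcomp Require Import lra.
From mathcomp Require Import all_classical all_reals all_analysis.

Local Open Scope classical_set_scope.
Local Open Scope ring_scope.

Import Order.TTheory GRing.Theory Num.Theory.

(** When [f] has dense range, finite shadowing forces [f] to be mixing, because
    mass can be moved between two unrelated orbits at a uniformly small cost per
    step.

    Changing the values of a fuzzy set by at most [e] moves its endograph by at
    most [e] ([endograph_dist_le_sup]).  Take points [x] and [y] and a large
    time [n].  Along the two orbits, the fuzzy set supported by [iter j f x] and
    [iter j f y] is sent by the Zadeh extension to the one supported by
    [iter j.+1 f x] and [iter j.+1 f y], with the same heights
    ([zadeh_two_point]).  Let the height on the orbit of [y] grow slowly from 0
    to 1, and then the height on the orbit of [x] decrease slowly from 1 to 0:
    at every time one of the heights is 1, so these are normal fuzzy sets, and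
    they form a chain ([handover_chain]) that starts at the characteristic
    function of [x] and ends at that of [iter n f y].  Given [delta], this works
    for all large [n] and for all [x] and [y].

    A fuzzy set [z] that shadows this chain has a point [p] of height 1.
    Such points are tracked exactly: [p] is close to the support of the first
    term, which is [x] ([endograph_dist_lt_support]), and [iter n f p] still has
    height 1 in the [n]-th image of [z] ([iter_zadeh_ge]), hence is close to
    [iter n f y].  So from near [x] one reaches, in exactly [n] steps, a
    neighbourhood of [iter n f y].  Density of the range lets [iter n f y]
    approximate any prescribed point ([dense_range_iter]), so [f] is mixing. *)

(** * Preliminaries on maxima and dense range *)

Lemma ler_dist_max (R : realDomainType) (a b c d e : R) :
  `|a - c| <= e -> `|b - d| <= e -> `|Num.max a b - Num.max c d| <= e.
Proof.
rewrite !ler_norml => /andP[? ?] /andP[? ?].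
by case: (leP a b) => ?; case: (leP c d) => ?; apply/andP; split; lra.
Qed.

(** The preimage of a non-empty open set under a continuous map with dense range
    is again non-empty and open, so the preimages can be iterated. *)
Lemma dense_range_iter {X : topologicalType} {f : X -> X} (n : nat) :
  continuous f -> dense (range f) -> dense (range (iter n f)).
Proof.
move=> fc df; elim: n => [|n IH] O O0 Oo.
  by case: O0 => x Ox; exists x; split => //; exists x.
have [_ [/[swap] -[y _ <-] Oy]] := df O O0 Oo.
have [|_ [/[swap] -[z _ <-] Oz]] :=
  IH (f @^-1` O) _ (open_comp (fun x _ => fc x) Oo); first by exists y.
by exists (f (iter n f z)); split => //; exists z.
Qed.

(** * Fuzzy sets supported by two points *)

Section two_point_fuzzy.
Context {R : realType} {X : metricType R}.

Definition spike (p : X) (alpha : R) (x : X) : R :=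
  if x == p then alpha else 0.

(** The points [p] and [q] may coincide, as two orbits may merge; the maximum
    then keeps the larger height, which is also what the Zadeh extension does. *)
Definition two_point (p q : X) (alpha beta : R) (x : X) : R :=
  Num.max (spike p alpha x) (spike q beta x).

Lemma spike_usc p alpha : 0 <= alpha -> upper_semicontinuous (spike p alpha).
Proof.
move=> a0 x c; rewrite /spike; case: eqP => [_ ac|/eqP xp c0].
  by apply: nearW => y; case: ifP => // _; exact: le_lt_trans ac.
have : nbhs x (~` [set p]).
  apply: open_nbhs_nbhs; split; last exact/eqP.
  rewrite openC; apply: accessible_closed_set1.
  exact/hausdorff_accessible/metric_hausdorff.
by apply: filterS => y /eqP/negPf ->.
Qed.

Lemma spike_dist p a b x : `|spike p a x - spike p b x| <= `|a - b|.
Proof. by rewrite /spike; case: ifP => // _; rewrite subrr normr0. Qed.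

Lemma two_point_gt0 p q alpha beta x :
  0 < two_point p q alpha beta x -> x = p \/ x = q.
Proof.
rewrite /two_point /spike; case: (eqVneq x p) => [|_]; first by left.
by case: (eqVneq x q) => [|_]; [right | rewrite maxxx ltxx].
Qed.

Context (p q : X) (alpha beta : R).
Hypotheses (alpha0 : 0 <= alpha) (beta0 : 0 <= beta)
  (alpha_beta : Num.max alpha beta = 1).

Lemma two_point_itv x : 0 <= two_point p q alpha beta x <= 1.
Proof.
rewrite le_max ge_max -alpha_beta !le_max /spike.
by do 2!case: ifP => _; rewrite ?lexx ?alpha0 ?beta0 ?orbT.
Qed.

Lemma two_point_usc : upper_semicontinuous (two_point p q alpha beta).
Proof.
move=> x c; rewrite gt_max => /andP[pc qc].
move: (spike_usc p _ alpha0 _ _ pc) (spike_usc q _ beta0 _ _ qc).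
by apply: filterS2 => y yp yq; rewrite gt_max yp.
Qed.

Lemma two_point_compact : compact (level (two_point p q alpha beta) 0).
Proof.
have cpq : compact [set p; q] by apply: finite_compact; exact: finite_set2.
apply: (subclosed_compact _ cpq).
  by rewrite /level eqxx; exact: closed_closure.
have pqcl : closed [set p; q].
  by apply: compact_closed cpq; exact: metric_hausdorff.
rewrite {1}/level eqxx ((closure_id [set p; q]).1 pqcl).
by apply: closureS => x /= /two_point_gt0.
Qed.

Lemma two_point_level1 : level (two_point p q alpha beta) 1 !=set0.
Proof.
rewrite /level oner_eq0 -alpha_beta /two_point.
case: (leP alpha beta) => _; [exists q | exists p];
  by rewrite /= /spike eqxx le_max lexx ?orbT.
Qed.

Definition two_point_fuzzy : normal_fuzzy R X :=
  NormalFuzzy two_point_itv two_point_usc two_point_compact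
    two_point_level1.

(** Each of the two peaks is pushed forward along [f].  The supremum over a fibre
    causes no loss: only [p] and [q] carry positive values. *)
Lemma zadeh_two_point {f : X -> X} (fc : continuous f) x :
  zadeh fc two_point_fuzzy x = two_point (f p) (f q) alpha beta x.
Proof.
have spike_f r a y : 0 <= a -> spike r a y <= spike (f r) a (f y).
  rewrite /spike => a0; case: (eqVneq y r) => [->|_]; first by rewrite eqxx.
  by case: ifP.
apply/eqP; rewrite eq_le; apply/andP; split.
  apply: zadeh_fun_le => [|y <-].
    by rewrite le_max /spike; case: ifP; rewrite ?alpha0 ?lexx.
  by rewrite /= /two_point ge_max !le_max !spike_f ?orbT.
have zge y :
    two_point p q alpha beta y <= zadeh fc two_point_fuzzy (f y).
  exact: (zadeh_fun_ge f two_point_fuzzy).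
have z0 : 0 <= zadeh fc two_point_fuzzy x.
  by case/andP: (membership_itv (zadeh fc two_point_fuzzy) x).
rewrite /two_point ge_max; apply/andP; split; rewrite {1}/spike.
  case: eqP => [->|//]; apply: le_trans (zge p).
  by rewrite le_max /spike eqxx lexx.
case: eqP => [->|//]; apply: le_trans (zge q).
by rewrite le_max /spike eqxx lexx orbT.
Qed.

End two_point_fuzzy.

(** * Estimates for the endograph metric *)

Section endograph_estimates.
Context {R : realType} {X : metricType R}.
Implicit Types u v : normal_fuzzy R X.

(** The nearest point of the other endograph can be taken on the same vertical
    fibre, which is why the uniform distance dominates the endograph metric. *)
Lemma endograph_dist_le_sup u v (e : R) :
  (forall x, `|u x - v x| <= e) -> endograph_dist u v <= e.
Proof.
have main u1 u2 : (forall x, `|u1 x - u2 x| <= e) ->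
    sup [set dist_to_set p (endograph u2) | p in endograph u1] <= e.
  move=> uv; apply: ge_sup; first by case: (endograph_dist_has_sup u1 u2).
  move=> _ [[x a] [/= /andP[a0 a1] au] <-].
  have e0 : 0 <= e by apply: le_trans (uv x); exact: normr_ge0.
  apply: (@le_trans _ _ (dist_bar (x, a) (x, Num.min a (u2 x)))).
    (* [u2 x] may exceed [a]: truncate there, since a higher point is farther. *)
    apply: ge_inf; first by case: (endograph_dist_to_set_has_inf (x, a) u2).
    exists (x, Num.min a (u2 x)) => //; split => /=.
      rewrite le_min a0 ge_min a1 /= andbT.
      by case/andP: (membership_itv u2 x).
    by rewrite ge_min lexx orbT.
  rewrite /dist_bar /= mdistxx ge_max e0 /=.
  move: (uv x); rewrite !ler_norml => /andP[? ?].
  by case: (leP a (u2 x)) => ?; apply/andP; split; lra.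
move=> uv; rewrite ge_max !main// => x.
by rewrite distrC.
Qed.

Lemma endograph_dist_lt u v (e : R) (p : X * R) :
  endograph_dist u v < e -> endograph u p ->
  exists2 c, endograph v c & dist_bar p c < e.
Proof.
move=> uve up.
have : dist_to_set p (endograph v) < e.
  apply: le_lt_trans uve; rewrite le_max; apply/orP; left.
  apply: ub_le_sup; last by exists p.
  by case: (endograph_dist_has_sup u v).
have [ne _] := endograph_dist_to_set_has_inf p v.
by move=> /(inf_lt ne) [_ [c vc <-] pc]; exists c.
Qed.

(** The bound [e <= 1] is what makes the endograph metric see the support: within
    distance less than 1 of a point of height 1 there is no point of height 0,
    and the points of height 0 belong to every endograph. *)
Lemma endograph_dist_lt_support u v (e : R) (x : X) :
  e <= 1 -> endograph_dist u v < e -> 1 <= u x ->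
  exists2 y, 0 < v y & mdist x y < e.
Proof.
move=> e1 uve u1.
have [|[y b] [_ vb]] := endograph_dist_lt u v e (x, 1) uve.
  by split => //=; rewrite ler01 lexx.
rewrite /dist_bar gt_max => /andP[xy] /=; rewrite ltr_norml => /andP[_ b1].
by exists y => //; apply: lt_le_trans vb; move: b1 => /=; lra.
Qed.

(** Heights never decrease along the orbit of a point, so a point of height 1
    keeps it at all times. *)
Lemma iter_zadeh_ge (f : X -> X) (fc : continuous f) u n x :
  u x <= iter n (zadeh fc) u (iter n f x).
Proof.
elim: n => //= n IH; apply: le_trans IH _.
exact: (zadeh_fun_ge f (iter n (zadeh fc) u)).
Qed.

End endograph_estimates.

(** * Chains between two orbits *)

Section ramp.
Context {R : realType}.
Variable K : nat.

(** A slope of [K.+1%:R^-1] instead of [K%:R^-1] makes division by zero impossible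
    for all [K]. *)
Definition ramp (j : nat) : R := Num.min 1 (j%:R / K.+1%:R).

Lemma ramp_ge0 j : 0 <= ramp j.
Proof. by rewrite le_min ler01 divr_ge0. Qed.

Lemma ramp0 : ramp 0 = 0.
Proof. by rewrite /ramp mul0r min_r// ler01. Qed.

Lemma ramp_le1 j : ramp j <= 1.
Proof. by rewrite ge_min lexx. Qed.

Lemma ramp1 j : (K < j)%N -> ramp j = 1.
Proof.
by move=> Kj; rewrite /ramp min_l// ler_pdivlMr ?mul1r ?ler_nat// ltr0n.
Qed.

Lemma ramp_step j : `|ramp j.+1 - ramp j| <= K.+1%:R^-1.
Proof.
have k0 : 0 <= K.+1%:R^-1 :> R by rewrite invr_ge0.
rewrite /ramp -addn1 natrD mulrDl mul1r ler_norml.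
set a := _ / _ : R; set b := _^-1 in k0 *.
by case: (leP 1 (a + b)) => ?; case: (leP 1 a) => ?; apply/andP; split; lra.
Qed.

(** When [i + j] is at least twice the length of the ramp, one of the two ramps
    has been completed.  This is where a chain needs time proportional to the
    inverse of its step. *)
Lemma max_ramp n i j : (K.+1.*2 <= n)%N -> (n <= i + j)%N ->
  Num.max (ramp i) (ramp j) = 1.
Proof.
move=> Kn nij; have [Ki|iK] := ltnP K i.
  by rewrite (ramp1 i)// max_l ?ramp_le1.
rewrite (ramp1 j) ?max_r ?ramp_le1//.
rewrite -(leq_add2l i); apply: leq_trans nij; apply: leq_trans Kn.
by rewrite -addnn leq_add2r (leq_trans iK).
Qed.

End ramp.

Section handover.
Context {R : realType} {X : metricType R}.
Variables (f : X -> X) (fc : continuous f).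
Variables (K n : nat) (Kn : (K.+1.*2 <= n)%N) (x y : X).

Lemma handover_normal j : Num.max (ramp K (n - j)) (ramp K j) = 1 :> R.
Proof. by apply: max_ramp Kn _; rewrite addnC -leq_subLR. Qed.

(** Both weights come from one ramp, run backwards on the orbit of [x]; as the two
    slopes do not overlap in time, the heights stay normal. *)
Definition handover (j : nat) : normal_fuzzy R X :=
  two_point_fuzzy (iter j f x) (iter j f y) _ _
    (ramp_ge0 K (n - j)) (ramp_ge0 K j) (handover_normal j).

Lemma handover0 z : 0 < handover 0 z -> z = x.
Proof.
rewrite /= /two_point ramp0 /spike; case: eqP => // _.
by rewrite if_same maxxx ltxx.
Qed.

Lemma handover_last z : 0 < handover n z -> z = iter n f y.
Proof.
rewrite /= /two_point subnn ramp0 /spike if_same; case: eqP => // _.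
by rewrite maxxx ltxx.
Qed.

Lemma handover_chain (delta : R) : K.+1%:R^-1 < delta ->
  is_chain endograph_dist (zadeh fc) delta n handover.
Proof.
move=> Kd j jn; apply: le_lt_trans Kd; apply: endograph_dist_le_sup => z.
rewrite zadeh_two_point /= /two_point.
apply: ler_dist_max; apply: le_trans (spike_dist _ _ _ _) _.
  by rewrite -(subnSK jn) ramp_step.
by rewrite distrC ramp_step.
Qed.

End handover.

Theorem theorem5p4 (R : realType) (X : metricType R) (f : X -> X)
    (fc : continuous f) :
  dense (range f) ->
  ~ topologically_mixing f ->
  ~ finite_shadowing (@endograph_dist R X) (zadeh fc).
Proof.
move=> df nmix shadow; apply: nmix => U V Uo Vo [x Ux] [v Vv].
have /nbhs_ballP[eU /= eU0 ballU] : nbhs x U by exact: open_nbhs_nbhs.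
have /nbhs_ballP[eV /= eV0 ballV] : nbhs v V by exact: open_nbhs_nbhs.
(* Half of [eV]: the other half is spent on the distance from [v] to
   [iter n f y]. *)
pose eps := Num.min 1 (Num.min eU (eV / 2)).
have eps0 : 0 < eps by rewrite !lt_min ltr01 eU0 divr_gt0.
have eps1 : eps <= 1 by rewrite ge_min lexx.
have epsU : eps <= eU by rewrite !ge_min lexx orbT.
have epsV : eps <= eV / 2 by rewrite !ge_min lexx !orbT.
have [delta delta0 shd] := shadow eps eps0.
have [K Kd] : exists K : nat, K.+1%:R^-1 < delta.
  have [K _ Kd] := near_infty_natSinv_lt (PosNum delta0).
  by exists K; apply: Kd => /=.
exists K.+1.*2 => // n Kn.
have dfn := dense_range_iter n fc df.
have vB : (ball v (eV / 2))^° v by apply: nbhsx_ballx; rewrite divr_gt0.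
have [|_ [/[swap] -[y _ <-] yv]] := dfn (ball v (eV / 2))^° _ (open_interior _).
  by exists v.
have {}yv : mdist v (iter n f y) < eV / 2.
  by move: (interior_subset yv); rewrite ballEmdist.
have [|z zs] := shd n (handover f K n Kn x y) _
  (handover_chain f fc K n Kn x y delta Kd).
  by apply: leq_trans Kn; rewrite doubleS.
have [p] := level1_neq0 z; rewrite /level oner_eq0 /= => p1.
have [_ /handover0-> px] :=
  endograph_dist_lt_support _ _ _ _ eps1 (zs 0%N (leq0n n)) p1.
have np1 : 1 <= iter n (zadeh fc) z (iter n f p).
  exact: le_trans (iter_zadeh_ge _ _ _ _ _).
have [_ /handover_last-> py] :=
  endograph_dist_lt_support _ _ _ _ eps1 (zs n (leqnn n)) np1.
exists (iter n f p); split.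
  exists p => //; apply: ballU; rewrite ballEmdist /=.
  by rewrite metric_sym; apply: lt_le_trans epsU.
apply: ballV; rewrite ballEmdist /=.
apply: le_lt_trans (metric_triangle _ (iter n f y) _) _.
rewrite [eV]splitr ltrD// metric_sym; exact: lt_le_trans epsV.
Qed.
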